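(* Let $p\ge1$, $\gamma=\frac{p-2}{p}$, let $T>0$, let $\pi=(\pi_n)_{n\ge1}$ be a sequence of partitions of $[0,T]$ with vanishing mesh, and let $x\in V^p_\pi([0,T],\mathbb{R})$. Put $\phi(t)=[x]^{(p)}_\pi(t)$. Assume that $\phi\in C^1_b([0,T],\mathbb{R})$ and that there exist constants $c,C$ with $0<c\le\phi'\le C<\infty$ on $[0,T]$. Then $$\limsup_{n}\langle x\rangle^{(p)}_{\pi_n}(T)<\infty\iff\limsup_n\sum_{i=0}^{N(\pi_n)-1}|\bigtriangleup t^n_i|^\gamma|\bigtriangleup x(t^n_i)|^2<\infty,$$ and $$\liminf_{n}\langle x\rangle^{(p)}_{\pi_n}(T)>0\iff\liminf_n\sum_{i=0}^{N(\pi_n)-1}|\bigtriangleup t^n_i|^\gamma|\bigtriangleup x(t^n_i)|^2>0.$$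
   Context: A sequence of partitions $\pi=(\pi_n)_{n\ge1}$ of $[0,T]$ consists of finite partitions $\pi_n=(0=t^n_0<t^n_1<\dots<t^n_{N(\pi_n)}=T)$, where $N(\pi_n)$ is the number of intervals; it has vanishing mesh if $\max_i (t^n_{i+1}-t^n_i)\to0$. We write $\bigtriangleup t^n_i:=t^n_{i+1}-t^n_i$ and $\bigtriangleup x(t^n_i):=x(t^n_{i+1})-x(t^n_i)$. The oscillation of $x\in C([0,T],\mathbb{R})$ along $\pi_n$ is $\mathrm{osc}(x,\pi_n):=\max_i\max_{r,s\in[t^n_i,t^n_{i+1}]}|x(s)-x(r)|$. $\delta(\cdot-s)$ denotes the Dirac mass at $s$; measures are finite measures on $[0,T]$. $p$-th variation: a continuous $x:[0,T]\to\mathbb{R}$ belongs to $V^p_\pi([0,T],\mathbb{R})$ if $\mathrm{osc}(x,\pi_n)\to0$ and the measures $\mu^n:=\sum_{i=0}^{N(\pi_n)-1}\delta(\cdot-t^n_i)|\bigtriangleup x(t^n_i)|^p$ converge weakly to a measure $\mu$ without atoms. Then $[x]^{(p)}_\pi(t):=\mu([0,t])$ is the $p$-th variation of $x$ along $\pi$, and $\Delta[x]^{(p)}_\pi(t^n_i):=[x]^{(p)}_\pi(t^n_{i+1})-[x]^{(p)}_\pi(t^n_i)$. Level-$n$ scaled quadratic variation of index $p$: with $\gamma=\frac{p-2}{p}$, $\langle x\rangle^{(p)}_{\pi_n}(t):=\mu^n_{SQV}([0,t])$, where $$\mu^n_{SQV}:=\sum_{i=0}^{N(\pi_n)-1}\delta(\cdot-t^n_i)\big(\Delta[x]^{(p)}_\pi(t^n_i)\big)^\gamma|\bigtriangleup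 x(t^n_i)|^2\,\mathbf{1}_{\Delta[x]^{(p)}_\pi(t^n_i)>0},$$ and terms with $\Delta[x]^{(p)}_\pi(t^n_i)=0$ are taken to be $0$ for every real $\gamma$. (The scaling uses increments of the limiting $p$-th variation $[x]^{(p)}_\pi$.) *)

(* Defs.v *)
From HB Require Import structures.
From mathcomp Require Import all_boot all_order all_algebra.
From mathcomp Require Import all_classical all_reals all_analysis.

Set Implicit Arguments.
Unset Strict Implicit.
Unset Printing Implicit Defensive.

Import Order.TTheory GRing.Theory Num.Theory numFieldNormedType.Exports.

Local Open Scope classical_set_scope.
Local Open Scope ring_scope.

Section Partitions.
Context {R : realType}.
Implicit Types (T : R) (s : seq R) (x : R -> R).

(* As in [itv_partition 0 T s], a partition 0 = t_0 < ... < t_N = T is given by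
   s = [:: t_1; ...; t_N]; thus N = size s and t_i is the i-th entry of 0 :: s. *)
Definition tpt s (i : nat) : R := nth 0 (0 :: s) i.

Definition dt s (i : nat) : R := tpt s i.+1 - tpt s i.

Definition incr x s (i : nat) : R := x (tpt s i.+1) - x (tpt s i).

Definition mesh s : R := \big[Num.max/0]_(i < size s) dt s i.

(* The inner supremum is a maximum when x is continuous. *)
Definition osc x s : R :=
  \big[Num.max/0]_(i < size s)
    sup [set z | exists u v, [/\ u \in `[tpt s i, tpt s i.+1],
                                 v \in `[tpt s i, tpt s i.+1] &
                                 z = `|x v - x u|]].

Definition partition_seq T (pi : nat -> seq R) : Prop :=
  forall n, itv_partition 0 T (pi n).

Definition vanishing_mesh (pi : nat -> seq R) : Prop :=
  mesh (pi n) @[n --> \oo] --> (0 : R).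

End Partitions.

Section PVariation.
Context {R : realType}.
Local Notation mR := (measurableTypeR R).
Implicit Types (T p : R) (s : seq R) (pi : nat -> seq R) (x : R -> R).

(* \sum_(i < N) w_i delta(. - t_i), the last point t_N = T carrying no mass. *)
Definition point_masses s (w : nat -> {nonneg R}) :
    {measure set mR -> \bar R} :=
  msum (fun i => mscale (w i) (dirac (tpt s i : mR))) (size s).

(* Measures on [0, T] are measures on R of which only the restriction to
   [0, T] is tested; a function continuous on [0, T] is bounded there. *)
Definition weak_cvg T (nu : nat -> {measure set mR -> \bar R})
    (mu : {measure set mR -> \bar R}) : Prop :=
  forall f : R -> R, {within `[0, T], continuous f} ->
    (\int[nu n]_(u in `[0%R, T]) (f u)%:E)%E @[n --> \oo] -->
    (\int[mu]_(u in `[0%R, T]) (f u)%:E)%E.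

Definition mu_pvar p x s : {measure set mR -> \bar R} :=
  point_masses s (fun i => (`|incr x s i| `^ p)%:nng).

Definition pvar_limit T p pi x
    (mu : {finite_measure set mR -> \bar R}) : Prop :=
  [/\ mu (~` `[0, T]) = 0%E,
      forall t : R, mu [set t] = 0%E &
      weak_cvg T (fun n => mu_pvar p x (pi n)) mu].

Definition Vp T p pi x : Prop :=
  [/\ {within `[0, T], continuous x},
      osc x (pi n) @[n --> \oo] --> (0 : R) &
      exists mu, pvar_limit T p pi x mu].

(* The p-th variation t |-> mu([0, t]); mu is unique if it exists, and the
   value is irrelevant otherwise. *)
Definition pvar T p pi x : R -> R :=
  get [set phi : R -> R | exists mu, pvar_limit T p pi x mu /\
                            phi = fun t => fine (mu `[0, t]%classic)].

(* [phi] stands for the limiting p-th variation. *)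
Definition sqv_weight (gam : R) (phi x : R -> R) s (i : nat) : R :=
  if 0 < incr phi s i then incr phi s i `^ gam * `|incr x s i| ^+ 2 else 0.

Lemma sqv_weight_ge0 gam phi x s i : 0 <= sqv_weight gam phi x s i.
Proof.
by rewrite /sqv_weight; case: ifP => // _; rewrite mulr_ge0// ?powR_ge0 ?exprn_ge0.
Qed.

Definition mu_sqv (gam : R) (phi x : R -> R) s : {measure set mR -> \bar R} :=
  point_masses s (fun i => NngNum (sqv_weight_ge0 gam phi x s i)).

Definition sqv T p pi x (n : nat) (t : R) : \bar R :=
  mu_sqv ((p - 2) / p) (pvar T p pi x) x (pi n) `[0, t]%classic.

End PVariation.

Section C1.
Context {R : realType}.
Implicit Types (T t : R) (f : R -> R).

(* Difference quotients stay inside [0, T], so derivatives are one-sided at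
   the endpoints. *)
Definition diffq f t (u : R) : R := (f u - f t) / (u - t).

Definition derive_in T f t : R :=
  lim (diffq f t u @[u --> within `[0, T]%classic t^']).

Definition C1b T f : Prop :=
  [/\ forall t, t \in `[0, T] -> cvg (diffq f t u @[u --> within `[0, T]%classic t^']),
      {within `[0, T], continuous (derive_in T f)},
      exists M, forall t, t \in `[0, T] -> `|f t| <= M &
      exists M, forall t, t \in `[0, T] -> `|derive_in T f t| <= M].

End C1.

(* Main.v *)
(** By the mean value theorem every increment of [phi] over a partition interval
    lies between [c * dt] and [C * dt]. As [a `^ gam] is bounded above and away
    from zero for [a] in [[c, C]], whatever the sign of [gam], each term of the
    scaled quadratic variation is comparable to the corresponding term of the
    time-weighted sum, uniformly in [i] and [n]. *)
Require Import Defs.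
From mathcomp Require Import all_boot all_order all_algebra.
From mathcomp Require Import all_classical all_reals all_analysis.
Import Order.TTheory GRing.Theory Num.Theory numFieldNormedType.Exports.
Local Open Scope classical_set_scope.
Local Open Scope ring_scope.

Lemma limn_esup_le (R : realType) (u v : (\bar R)^nat) :
  (forall n, u n <= v n)%E -> (limn_esup u <= limn_esup v)%E.
Proof.
move=> uv; apply/ereal_infP => _ [V FV <-].
apply: (@le_trans _ _ (ereal_sup (u @` V))).
  by apply: ereal_inf_lbound; exists V.
apply/ereal_supP => _ [n Vn <-]; apply: le_trans (uv n) _.
by apply: ereal_sup_ubound; exists n.
Qed.

(** An upper limit is an infimum of suprema over the sets of the filter, and a positive real factor
    commutes with both. *)
Lemma limn_esup_pZl (R : realType) (u : (\bar R)^nat) (k : R) : 0 < k ->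
  limn_esup (fun n => k%:E * u n)%E = (k%:E * limn_esup u)%E.
Proof.
move=> k0; rewrite /limn_esup /limf_esup -ereal_inf_pZl// image_comp.
congr ereal_inf; apply: eq_imagel => V _ /=.
by rewrite -ereal_sup_pZl// image_comp.
Qed.

Lemma limn_einf_pZl (R : realType) (u : (\bar R)^nat) (k : R) : 0 < k ->
  limn_einf (fun n => k%:E * u n)%E = (k%:E * limn_einf u)%E.
Proof.
move=> k0; rewrite /limn_einf muleN -limn_esup_pZl//; congr (- limn_esup _)%E.
by apply/funext => n; rewrite muleN.
Qed.

Lemma limn_einf_le (R : realType) (u v : (\bar R)^nat) :
  (forall n, u n <= v n)%E -> (limn_einf u <= limn_einf v)%E.
Proof.
by move=> uv; rewrite /limn_einf leeN2; apply: limn_esup_le => n; rewrite leeN2.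
Qed.

(** A real power is monotone on the positive reals, so the endpoints provide both bounds. For
    [g < 0] it is the reciprocal of the increasing power [- g], and the endpoints swap roles. *)
Lemma powR_itv_bounds (R : realType) (c C g : R) : 0 < c -> c <= C ->
  exists k K : R, [/\ 0 < k, 0 < K &
    forall a, c <= a <= C -> k <= a `^ g <= K].
Proof.
move=> c0 cC; have C0 := lt_le_trans c0 cC.
have pos a : c <= a <= C -> 0 < a by case/andP => ca _; exact: lt_le_trans ca.
have mono r a b : 0 <= r -> 0 < a -> a <= b -> a `^ r <= b `^ r.
  move=> r0 a0 ab; apply: ge0_ler_powR => //; rewrite nnegrE ?ltW//.
  exact: lt_le_trans ab.
have [g0|g0] := leP 0 g.
  exists (c `^ g), (C `^ g); split; rewrite ?powR_gt0// => a aI.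
  have a0 := pos _ aI; case/andP: aI => ca aC.
  by rewrite !mono.
exists (C `^ g), (c `^ g); split; rewrite ?powR_gt0// => a aI.
have a0 := pos _ aI; case/andP: aI => ca aC.
by rewrite -(opprK g) !(powRN _ (- g)) !lef_pV2 ?posrE ?powR_gt0// !mono//
  oppr_ge0 ltW.
Qed.

Section Partition.
Context {R : realType}.
Implicit Types (T : R) (s : seq R).

Lemma tpt_itv T s i : itv_partition 0 T s -> (i <= size s)%N ->
  0 <= tpt s i <= T.
Proof.
(* [tpt] reads the list with default 0, the library bounds with default [T]; for [i <= size s] the
   two readings agree. *)
move=> sT si; rewrite /tpt (set_nth_default T) ?ltnS//.
by rewrite (@itv_partition_nth_ge _ _ _ T)// itv_partition_nth_le.
Qed.

Lemma dt_gt0 T s i : itv_partition 0 T s -> (i < size s)%N -> 0 < dt s i.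
Proof.
move=> [s_lt _] si; rewrite subr_gt0 /tpt.
have /(_ i i.+1) := sorted_ltn_nth lt_trans 0 (s_lt : sorted <%R (0 :: s)).
by apply; rewrite ?inE/= ?ltnS// ltnW.
Qed.

End Partition.

Section DifferenceQuotient.
Context {R : realType}.
Implicit Types (T t l : R) (f : R -> R).

(** Away from [t], [f u] equals [f t + diffq f t u * (u - t)], whose second term tends to [l * 0].
    This includes the endpoints of [[0, T]], where the derivative is one-sided. *)
Lemma diffq_cvg_within T f t l :
  diffq f t u @[u --> within `[0, T]%classic t^'] --> l ->
  f u @[u --> within `[0, T]%classic (nbhs t)] --> f t.
Proof.
move=> fl.
have : f t + diffq f t u * (u - t) @[u --> within `[0, T]%classic t^']
    --> f t + l * (t - t).
  apply: cvgD; first exact: cvg_cst.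
  apply: cvgM => //; apply: cvgB; last exact: cvg_cst.
  by move=> A tA; rewrite /within/= /dnbhs/within/=; apply: filterS tA.
rewrite subrr mulr0 addr0 => /cvgrPdist_lt fc.
apply/cvgrPdist_lt => e e0.
(* The filter in [fc] is punctured at [t], the target filter is not; the missing case [u = t] is
   trivial. *)
have h : \forall u \near t, u != t -> `[0, T]%classic u ->
  `|f t - (f t + diffq f t u * (u - t))| < e := fc e e0.
apply: filterS h => u h uT.
have [->|ut] := eqVneq u t; first by rewrite subrr normr0.
by have := h ut uT; rewrite /diffq mulfVK ?subr_eq0// addrCA subrr addr0.
Qed.

(** An interior point has a neighbourhood inside [[0, T]], so the restriction to [[0, T]] drops out
    and the shift [u = k + t] gives the usual quotient. *)
Lemma diffq_is_derive T f t l : t \in `]0, T[ ->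
  diffq f t u @[u --> within `[0, T]%classic t^'] --> l ->
  is_derive t 1 f l.
Proof.
move=> tT /cvgrPdist_lt fl.
have H : h^-1 *: (f (h *: 1 + t) - f t) @[h --> 0^'] --> l.
  apply/cvgrPdist_lt => e e0.
  have h : \forall u \near t, u != t -> `[0, T]%classic u ->
    `|l - diffq f t u| < e := fl e e0.
  have : \forall u \near t, u != t -> `|l - diffq f t u| < e.
    apply: filterS2 h (near_in_itvoo tT) => u h uT ut.
    by apply: h => //; apply: subset_itv_oo_cc.
  rewrite (near_shift 0 t) /= subr0; apply: filterS => k hk k0.
  have kt : k + t != t by rewrite -subr_eq0 addrK.
  have := hk kt; rewrite /diffq addrK.
  by rewrite -[k *: 1]/(k * 1) mulr1 mulrC.
by apply: DeriveDef; [apply/cvg_ex; exists l|exact/cvg_lim].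
Qed.

Lemma incr_bounds T f (c C : R) : C1b T f ->
  (forall t, t \in `[0, T] -> c <= derive_in T f t <= C) ->
  forall s, itv_partition 0 T s -> forall i, (i < size s)%N ->
  c * dt s i <= incr f s i <= C * dt s i.
Proof.
move=> [df _ _ _] dfcC s sT i si.
have /andP[a0 aT] := tpt_itv _ _ _ sT (ltnW si).
have /andP[b0 bT] := tpt_itv _ _ _ sT si.
have := dt_gt0 _ _ _ sT si; rewrite subr_gt0 => ab.
have [||t] := @MVT R f (derive_in T f) _ _ ab.
- move=> t; rewrite in_itv/= => /andP[ta tb]; apply: (@diffq_is_derive T).
    by rewrite in_itv/= (le_lt_trans a0 ta) (lt_le_trans tb bT).
  apply: df; rewrite in_itv/= (ltW (le_lt_trans a0 ta)).
  by rewrite (ltW (lt_le_trans tb bT)).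
(* The partition interval may touch 0 or [T], where no two-sided derivative is at hand; continuity
   there comes from the one-sided quotients. *)
- have sub : `[tpt s i, tpt s i.+1]%classic `<=` `[0, T]%classic.
    move=> t /=; rewrite !in_itv/= => /andP[ta tb].
    by rewrite (le_trans a0 ta) (le_trans tb bT).
  apply: continuous_subspaceW sub _; apply/subspace_continuousP => t tT.
  by apply: (@diffq_cvg_within T _ _ (derive_in T f t)); exact: df.
rewrite in_itv/= => /andP[ta tb] fab.
have /dfcC/andP[ct tC] : t \in `[0, T].
  by rewrite in_itv/= (ltW (le_lt_trans a0 ta)) (ltW (lt_le_trans tb bT)).
by rewrite /incr fab !ler_pM2r ?ct ?subr_gt0.
Qed.

End DifferenceQuotient.

(** All partition points lie in [[0, T]], so each Dirac mass gives this interval measure 1. *)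
Lemma sqvE (R : realType) (p T : R) (pi : nat -> seq R) (x : R -> R) n :
  itv_partition 0 T (pi n) ->
  sqv T p pi x n T = (\sum_(i < size (pi n))
    sqv_weight ((p - 2) / p) (pvar T p pi x) x (pi n) i)%:E.
Proof.
move=> piT; rewrite /sqv /mu_sqv /point_masses /= /msum -sumEFin.
apply: eq_bigr => i _.
rewrite [LHS]/(_ * \d_(tpt (pi n) i) _)%E diracE mem_set/= -?EFinM ?mulr1//.
by rewrite in_itv/= (tpt_itv T (pi n) i piT)// ltnW.
Qed.

(** Factor [incr phi s i] as a ratio in [[c, C]] times [dt s i]: the power splits accordingly, and
    only the ratio's power has to be estimated. Positivity of [c * dt s i] selects the nonzero
    branch of [sqv_weight]. *)
Lemma sqv_weight_bounds (R : realType) (g c C : R) (phi x : R -> R) s i k K :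
  0 < c -> (forall a, c <= a <= C -> k <= a `^ g <= K) -> 0 < dt s i ->
  c * dt s i <= incr phi s i <= C * dt s i ->
  k * (`|dt s i| `^ g * `|incr x s i| ^+ 2) <= sqv_weight g phi x s i <=
  K * (`|dt s i| `^ g * `|incr x s i| ^+ 2).
Proof.
move=> c0 kK d0 /andP[cphi phiC].
have phi0 : 0 < incr phi s i by apply: lt_le_trans cphi; exact: mulr_gt0.
have /kK/andP[ka aK] : c <= incr phi s i / dt s i <= C.
  by rewrite ler_pdivlMr// ler_pdivrMr// cphi.
rewrite /sqv_weight phi0 (gtr0_norm d0) !mulrA.
have -> : incr phi s i `^ g = (incr phi s i / dt s i) `^ g * dt s i `^ g.
  by rewrite -powRM ?divfK ?gt_eqF// ?divr_ge0// ltW.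
by rewrite !ler_wpM2r ?powR_ge0 ?exprn_ge0.
Qed.

Lemma limn_esup_lty_comparable (R : realType) (u v : (\bar R)^nat) (k K : R) :
  0 < k -> 0 < K -> (forall n, k%:E * v n <= u n <= K%:E * v n)%E ->
  (limn_esup u < +oo)%E <-> (limn_esup v < +oo)%E.
Proof.
move=> k0 K0 uv; split=> [u_fin|v_fin].
- have := @limn_esup_le R _ u (fun n => proj1 (andP (uv n))).
  rewrite limn_esup_pZl// => /le_lt_trans/(_ u_fin).
  (* The value [+oo] is excluded because [k * +oo = +oo] for [k > 0]. *)
  by case: (limn_esup v) => [r| |]//; rewrite ?ltry ?gt0_muley ?lte_fin.
- have := @limn_esup_le R u _ (fun n => proj2 (andP (uv n))).
  rewrite limn_esup_pZl// => /le_lt_trans; apply.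
  case: (limn_esup v) v_fin => [r| |]// _; first by rewrite -EFinM ltry.
  by rewrite gt0_muleNy ?lte_fin.
Qed.

(** Compared with finiteness of upper limits, the bounds trade places: positivity goes from [u] to
    [v] by the upper one and back by the lower one. *)
Lemma limn_einf_gt0_comparable (R : realType) (u v : (\bar R)^nat) (k K : R) :
  0 < k -> 0 < K -> (forall n, k%:E * v n <= u n <= K%:E * v n)%E ->
  (0 < limn_einf u)%E <-> (0 < limn_einf v)%E.
Proof.
move=> k0 K0 uv; split=> [u0|v0].
- have := @limn_einf_le R u _ (fun n => proj2 (andP (uv n))).
  by rewrite limn_einf_pZl// => /(lt_le_trans u0); rewrite pmule_rgt0 ?lte_fin.
- have := @limn_einf_le R _ u (fun n => proj1 (andP (uv n))).
  by rewrite limn_einf_pZl//; apply: lt_le_trans; rewrite mule_gt0 ?lte_fin.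
Qed.

Theorem lemma2p10 (R : realType) (p T : R) (pi : nat -> seq R) (x : R -> R)
    (c C : R) (hp : 1 <= p) (hT : 0 < T)
    (hpi : partition_seq T pi) (hmesh : vanishing_mesh pi)
    (hx : Vp T p pi x)
    (hphi : C1b T (pvar T p pi x))
    (hc : 0 < c)
    (hcC : forall t, t \in `[0, T] ->
             c <= derive_in T (pvar T p pi x) t <= C) :
  let gam := (p - 2) / p in
  let S := fun n => \sum_(i < size (pi n))
             `|dt (pi n) i| `^ gam * `|incr x (pi n) i| ^+ 2 in
  ((limn_esup (fun n => sqv T p pi x n T) < +oo)%E <->
   (limn_esup (fun n => (S n)%:E) < +oo)%E) /\
  ((0 < limn_einf (fun n => sqv T p pi x n T))%E <->
   (0 < limn_einf (fun n => (S n)%:E))%E).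
Proof.
move=> gam S.
(* Evaluating the derivative bounds at the point 0 yields [c <= C]. *)
have /hcC/andP[c0 C0] : (0 : R) \in `[0, T] by rewrite in_itv/= lexx ltW.
have [k [K [k0 K0 kK]]] := powR_itv_bounds R c C gam hc (le_trans c0 C0).
(* [k] and [K] depend only on [c], [C] and [gam], so the termwise bounds add up with the same
   constants for every [n]. *)
have uv n : (k%:E * (S n)%:E <= sqv T p pi x n T <= K%:E * (S n)%:E)%E.
  rewrite sqvE// -!EFinM !lee_fin !mulr_sumr.
  have w (i : 'I_(size (pi n))) := sqv_weight_bounds R gam c C
    (pvar T p pi x) x (pi n) i k K hc kK
    (dt_gt0 _ _ _ (hpi n) (ltn_ord i))
    (incr_bounds _ _ _ _ hphi hcC _ (hpi n) _ (ltn_ord i)).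
  by apply/andP; split; apply: ler_sum => i _; case/andP: (w i).
split.
- exact: limn_esup_lty_comparable k0 K0 uv.
- exact: limn_einf_gt0_comparable k0 K0 uv.
Qed.
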